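(* Let $K=(k_1,k_2,\ldots,k_r)$ be a finite sequence of positive integers, let $B=\{b_1,\ldots,b_r\}$ be the place value set generated by $K$, and let $$R=\{(i_r,i_{r-1},\ldots,i_{r-q}) : q\in\{0,1,\ldots,r-1\},\ 0\le i_x\le k_x-1 \text{ for every } x\in\{r-q,\ldots,r\}\}.$$ Then the function $F$ from $R$ to the non-negative integers defined by $$F\big((i_r,i_{r-1},\ldots,i_{r-q})\big)=i_rb_r+i_{r-1}b_{r-1}+\cdots+i_{r-q}b_{r-q}+q \qquad \text{for } (i_r,\ldots,i_{r-q})\in R$$ is injective. (If $F((i_r,\ldots,i_{r-p}))=n$ with $(i_r,\ldots,i_{r-p})\in R$, the sequence $(i_r,\ldots,i_{r-p})$ is called the Distance Sensitive Number Representation of $n$ with respect to $B$, denoted $R_B(n)$, and $p$ is called the distance term of $R_B(n)$; $R$ is called the Distance Sensitive number system associated with the place value set $B$.)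
   Context: For a sequence $K=(k_1,\ldots,k_r)$ of positive integers ($r\ge 1$), called a base or radix sequence, put $b_1=1$ and, for $q\in\{2,\ldots,r,r+1\}$, $$b_q=1+k_{q-1}+k_{q-1}k_{q-2}+\cdots+k_{q-1}k_{q-2}\cdots k_1.$$ The set $B=\{b_q : 1\le q\le r\}$ is called the place value set generated by $K$. The elements of $R$ are finite sequences of lengths $1,\ldots,r$ (an element with parameter $q$ has length $q+1$); sequences of different lengths are distinct elements of $R$. *)

(* Defs.v *)
From mathcomp Require Import all_boot.

Set Implicit Arguments.
Unset Strict Implicit.
Unset Printing Implicit Defensive.

(* A radix sequence (k_1, ..., k_r) is a list K of naturals with r = size K;
   subscripts start at 1. *)
Definition radix (K : seq nat) (x : nat) : nat := nth 0 K x.-1.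

Definition radix_sequence (K : seq nat) : Prop :=
  0 < size K /\ forall x, 1 <= x <= size K -> 0 < radix K x.

(* b_q = 1 + k_{q-1} + k_{q-1} k_{q-2} + ... + k_{q-1} k_{q-2} ... k_1 for
   q >= 1: the j-th summand is the product of the j factors
   k_{q-1}, ..., k_{q-j}. In particular b_1 = 1. *)
Definition place_value (K : seq nat) (q : nat) : nat :=
  \sum_(0 <= j < q) \prod_(q - j <= x < q) radix K x.

(* A numeral (i_r, i_{r-1}, ..., i_{r-q}) is a list with the leading digit i_r
   first, so that i_x is its entry number r - x, and q is its length minus 1. *)
Definition digit (K s : seq nat) (x : nat) : nat := nth 0 s (size K - x).

Definition distance_term (s : seq nat) : nat := (size s).-1.

Definition ds_number_system (K : seq nat) : pred (seq nat) :=
  fun s => (1 <= size s <= size K) &&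
    all (fun x => digit K s x < radix K x)
        (index_iota (size K - distance_term s) (size K).+1).

Definition ds_value (K s : seq nat) : nat :=
  \sum_(size K - distance_term s <= x < (size K).+1)
     digit K s x * place_value K x
  + distance_term s.

(* Main.v *)
Require Import Defs.
From mathcomp Require Import all_boot.

(** The place values satisfy [b_(q+1) = 1 + k_q * b_q].  For a numeral with
    leading digit [d] in position [r], write its value plus one as
    [1 + d * b_r + t], where [t] is zero if no digit follows, and otherwise is
    the value plus one of the numeral formed by the remaining digits, read from
    position [r - 1]: the distance term grows by one for each digit, so it
    pays for this shift.

    By the recurrence, [t < b_r] for all such tails ([ds_rank_lt]).  Thus [d]
    and [t] are the quotient and the remainder of the value by [b_r], and the
    digits are recovered one after the other.  The end of the numeral is also
    detected, since [t] is zero only for the empty tail; this is why numerals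
    of different lengths cannot collide ([ds_rank_inj]). *)

Lemma place_valueS (K : seq nat) (q : nat) :
  place_value K q.+1 = (radix K q * place_value K q).+1.
Proof.
rewrite /place_value big_nat_recl // subn0 big_geq // add1n; congr _.+1.
rewrite big_distrr /=; apply: eq_big_nat => j /andP[_ lt_jq].
by rewrite subSS big_nat_recr ?leq_subr //= mulnC.
Qed.

(** The value plus one of the numeral [s] whose leading digit has place [r],
    extended by [0] to the empty sequence.  The shift by one makes the
    recursion uniform and separates the empty sequence from all numerals. *)
Fixpoint ds_rank (K : seq nat) (r : nat) (s : seq nat) : nat :=
  if s is d :: s' then (d * place_value K r + ds_rank K r.-1 s').+1 else 0.

Fixpoint admissible (K : seq nat) (r : nat) (s : seq nat) : bool :=
  if s is d :: s' then [&& 0 < r, d < radix K r & admissible K r.-1 s']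
  else true.

(** With the leading digit at most [k_r - 1] and the tail below [b_r], the rank
    is at most [(k_r - 1) * b_r + b_r = b_(r+1) - 1]. *)
Lemma ds_rank_lt (K : seq nat) (r : nat) (s : seq nat) :
  admissible K r s -> ds_rank K r s < place_value K r.+1.
Proof.
elim: s r => [|d s IHs] r /=; first by rewrite place_valueS.
case: r => [//|r] /= /andP[lt_dk adm_s].
rewrite [place_value K r.+2]place_valueS ltnS.
apply: leq_trans (leq_mul lt_dk (leqnn _)).
by rewrite mulSn addnC ltn_add2r IHs.
Qed.

Lemma ds_rank_inj (K : seq nat) (r : nat) :
  {in admissible K r &, injective (ds_rank K r)}.
Proof.
move=> s t; rewrite -!topredE /=.
elim: s r t => [|d s IHs] r [|e t] //=.
case: r => [//|r] /= /andP[_ adm_s] /andP[_ adm_t] [eq_st].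
have lt_s := ds_rank_lt _ _ _ adm_s; have lt_t := ds_rank_lt _ _ _ adm_t.
have b_gt0 : 0 < place_value K r.+1 by rewrite place_valueS.
have eq_de : d = e.
  have := congr1 (divn^~ (place_value K r.+1)) eq_st.
  by rewrite !divnMDl // !divn_small // !addn0.
rewrite eq_de in eq_st *; move/addnI in eq_st.
by rewrite (IHs r t).
Qed.

Lemma ds_rankE (K : seq nat) (r : nat) (s : seq nat) : size s <= r ->
  ds_rank K r s =
    \sum_(r.+1 - size s <= x < r.+1) nth 0 s (r - x) * place_value K x
    + size s.
Proof.
elim: s r => [|d s IHs] r /=; first by rewrite subn0 big_geq.
case: r => [//|r] le_sr.
rewrite subSS big_nat_recr ?leq_subr //= subnn IHs //=.
rewrite addnS addnA [d * _ + _]addnC; congr (_ + _ + _).+1.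
by apply: eq_big_nat => x /andP[_ lt_xr]; rewrite subSn.
Qed.

Lemma admissibleP (K : seq nat) (r : nat) (s : seq nat) : size s <= r ->
  (forall x, r.+1 - size s <= x < r.+1 -> nth 0 s (r - x) < radix K x) ->
  admissible K r s.
Proof.
elim: s r => [//|d s IHs] [//|r] /= le_sr digits_ok.
have := digits_ok r.+1; rewrite subSS leq_subr ltnSn subnn => -> //=.
apply: IHs => // x /andP[le_x lt_xr].
by have := digits_ok x; rewrite subSS le_x ltnW //= subSn //; apply.
Qed.

(** The digits of a numeral occupy the places from [r - q] to [r]; as it has
    [q + 1] digits, the lower end is also [r + 1] minus its length. *)
Lemma lowest_placeE (K s : seq nat) : 0 < size s ->
  size K - distance_term s = (size K).+1 - size s.
Proof. by rewrite /distance_term; case: s. Qed.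

Lemma ds_number_system_admissible (K s : seq nat) :
  s \in ds_number_system K -> admissible K (size K) s.
Proof.
case/andP=> /andP[s_gt0 le_sK]; rewrite lowest_placeE // => /allP digits_ok.
by apply: admissibleP => // x x_in; apply: digits_ok; rewrite mem_index_iota.
Qed.

Lemma ds_valueS (K s : seq nat) : s \in ds_number_system K ->
  (ds_value K s).+1 = ds_rank K (size K) s.
Proof.
case/andP=> /andP[s_gt0 le_sK] _.
by rewrite ds_rankE // /ds_value lowest_placeE // -addnS prednK.
Qed.

Theorem theorem3p1 (K : seq nat) (hK : radix_sequence K) :
  {in ds_number_system K &, injective (ds_value K)}.
Proof.
move=> s t s_in t_in eq_st.
apply: (ds_rank_inj K (size K)); try exact: ds_number_system_admissible.
by rewrite -!ds_valueS // eq_st.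
Qed.
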